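(* Let $n>1$ and let $F_n$ be the free group on $n$ generators. Then the space $LO(F_n)$ has no isolated points. Equivalently, the free lattice ordered group $F(F_n)$ over $F_n$ has no basic elements.
   Context: For a group $G$, $LO(G)$ is the set of all positive cones of left orderings of $G$, i.e. subsets $P \subset G$ with $P\cdot P \subset P$ and $P \sqcup P^{-1} \sqcup \{1\} = G$ (disjoint union). Each $P$ determines a left ordering $<_P$ by $g <_P h \iff g^{-1}h \in P$. $LO(G)$ carries the topology with subbasis the sets $U_g = \{P \in LO(G) : g \in P\}$, $g \in G$. For $P \in LO(G)$, $Aut(G,<_P)$ is the group of order-preserving bijections of the totally ordered set $(G,<_P)$; it is a lattice-ordered group whose lattice operations are pointwise: $(f\vee g)(x)=\max\{f(x),g(x)\}$, $(f\wedge g)(x)=\min\{f(x),g(x)\}$ with respect to $<_P$. For $g\in G$ let $g_P \in Aut(G,<_P)$ be left multiplication, $g_P(h)=gh$. Let $i: G \to \prod_{P \in LO(G)} Aut(G,<_P)$ be $g \mapsto (g_P)_P$, the product having componentwise group and lattice operations. For a left orderable group $G$, the free lattice ordered group $F(G)$ over $G$ is the smallest subset of this product containing $i(G)$ and closed under the group and lattice operations. The lattice ordering on $F(G)$ is $x \preceq y \iff x\wedge y = x$. An element $x$ of a lattice-ordered group $L$ with $x \succ 1$ (i.e. $1 \preceq x$ and $x \neq 1$) is called a basic element if the set $\{y \in L : 1 \preceq y \preceq x\}$ is totally ordered by the restriction of the lattice ordering. *)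

(* Defs.v *)
From HB Require Import structures.
From mathcomp Require Import all_boot all_order.
From mathcomp Require Import boolp classical_sets topology.

Set Implicit Arguments.
Unset Strict Implicit.
Unset Printing Implicit Defensive.

Import Order.TTheory.

Local Open Scope classical_set_scope.
Local Open Scope group_scope.

(* The free group on a type X of generators: reduced words, where the letter
   (x, false) stands for x and (x, true) for x^-1. *)
Section FreeGroup.
Variable X : choiceType.
Local Notation letter := (X * bool)%type.
Implicit Types (a b : letter) (u v w : seq letter).

Definition inv_letter a : letter := (a.1, ~~ a.2).

Definition reduced w : bool := sorted (fun a b => b != inv_letter a) w.

Record free_group : Type :=
  FreeGroup { word : seq letter; word_reduced : reduced word }.

HB.instance Definition _ := [isSub for word].
HB.instance Definition _ := [Choice of free_group by <:].

Definition cons_reduce a w : seq letter :=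
  if w is b :: w' then if b == inv_letter a then w' else a :: w else [:: a].

Definition concat_reduce u v : seq letter := foldr cons_reduce v u.

Definition inv_word w : seq letter := rev (map inv_letter w).

Lemma inv_letterK : involutive inv_letter.
Proof. by case=> x b; rewrite /inv_letter /= negbK. Qed.

Lemma cons_reduce_reduced a w : reduced w -> reduced (cons_reduce a w).
Proof.
case: w => [//|b w] /= rw; case: eqVneq => [_|ne]; first exact: path_sorted rw.
by rewrite /reduced /= ne.
Qed.

Lemma cons_reduceK a w : reduced w ->
  cons_reduce a (cons_reduce (inv_letter a) w) = w.
Proof.
case: w => [|b w] /=; first by rewrite eqxx.
rewrite inv_letterK; case: eqVneq => [->|ne] rw /=; last by rewrite eqxx.
by case: w rw => [//|c w] /= /andP[/negPf -> _].
Qed.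

Lemma concat_reduced u v : reduced v -> reduced (concat_reduce u v).
Proof. by move=> rv; elim: u => //= a u; exact: cons_reduce_reduced. Qed.

Lemma concat_reduceA u v w : reduced v -> reduced w ->
  concat_reduce u (concat_reduce v w) = concat_reduce (concat_reduce u v) w.
Proof.
move=> rv rw; elim: u => //= a u ->.
have: reduced (concat_reduce u v) by exact: concat_reduced.
case: (concat_reduce u v) => [//|b t] /= rt.
case: eqVneq => [->|//]; rewrite cons_reduceK //; exact: concat_reduced.
Qed.

Lemma concat_reduce0 u : reduced u -> concat_reduce u [::] = u.
Proof.
elim: u => //= a u IHu rau; rewrite IHu; last exact: path_sorted rau.
by case: u rau {IHu} => [//|b u] /= /andP[/negPf ->].
Qed.

Lemma inv_wordK : involutive inv_word.
Proof.
by move=> w; rewrite /inv_word map_rev revK mapK //; exact: inv_letterK.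
Qed.

Lemma inv_word_reduced w : reduced w -> reduced (inv_word w).
Proof.
rewrite /reduced /inv_word rev_sorted sorted_map; apply: sub_sorted => a b /=.
by apply: contraNneq => ->; rewrite inv_letterK.
Qed.

Lemma concat_reduceVK u w : reduced w ->
  concat_reduce (inv_word u) (concat_reduce u w) = w.
Proof.
move=> rw; elim: u => //= a u IHu.
rewrite /inv_word /= rev_cons -cats1 {1}/concat_reduce foldr_cat /=.
by rewrite -{2}[a]inv_letterK cons_reduceK //; exact: concat_reduced.
Qed.

Definition free_mul (g h : free_group) : free_group :=
  FreeGroup (concat_reduced (word g) (word_reduced h)).

Definition free_one : free_group := FreeGroup (isT : reduced [::]).

Definition free_inv (g : free_group) : free_group :=
  FreeGroup (inv_word_reduced (word_reduced g)).

Lemma free_mulA : associative free_mul.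
Proof.
by move=> g h k; apply: val_inj; apply: concat_reduceA; apply: word_reduced.
Qed.

Lemma free_mul1g : left_id free_one free_mul.
Proof. by move=> g; apply: val_inj. Qed.

Lemma free_mulg1 : right_id free_one free_mul.
Proof. by move=> g; apply: val_inj; apply: concat_reduce0 (word_reduced g). Qed.

Lemma free_mulVg : left_inverse free_one free_inv free_mul.
Proof.
move=> g; apply: val_inj => /=.
rewrite -{2}(concat_reduce0 (word_reduced g)); exact: concat_reduceVK.
Qed.

Lemma free_mulgV : right_inverse free_one free_inv free_mul.
Proof.
move=> g; apply: val_inj => /=; rewrite -{1}[word g]inv_wordK.
rewrite -[X in concat_reduce _ X](concat_reduce0 _); last first.
  exact: inv_word_reduced (word_reduced g).
exact: concat_reduceVK.
Qed.

HB.instance Definition _ := isGroup.Build free_group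
  free_mulA free_mul1g free_mulg1 free_mulVg free_mulgV.

Definition free_gen (x : X) : free_group :=
  FreeGroup (isT : reduced [:: (x, false)]).

Section UniversalProperty.
Variables (H : groupType) (f : X -> H).

Definition free_lift_letter a : H := if a.2 then (f a.1)^-1 else f a.1.

Definition free_lift (g : free_group) : H :=
  foldr (fun a h => free_lift_letter a * h) 1 (word g).

Lemma free_lift_gen x : free_lift (free_gen x) = f x.
Proof. exact: mulg1. Qed.

Lemma free_liftM : {morph free_lift : g h / g * h}.
Proof.
move=> [u ru] [v rv]; rewrite /free_lift /= {ru}.
elim: u => [|a u IHu] /=; first by rewrite mul1g.
rewrite -mulgA -{}IHu; case: (concat_reduce u v) => [//|b t] /=.
case: eqVneq => [->|//]; rewrite /free_lift_letter /= mulgA.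
by case: a.2; rewrite /= ?mulVg ?mulgV mul1g.
Qed.

Lemma free_lift_unique (phi : free_group -> H) :
  {morph phi : g h / g * h} -> (forall x, phi (free_gen x) = f x) ->
  phi =1 free_lift.
Proof.
move=> phiM phif.
have phi1 : phi 1 = 1.
  by apply: (@mulgI _ (phi 1)); rewrite -phiM !mulg1.
have phiV g : phi g^-1 = (phi g)^-1.
  by apply: (@mulgI _ (phi g)); rewrite -phiM !mulgV.
case=> w; elim: w => [|a w IHw] rw.
  by have -> : FreeGroup rw = 1 by exact: val_inj.
have rw' : reduced w by exact: path_sorted rw.
have ra : reduced [:: a] by [].
have {1}-> : FreeGroup rw = FreeGroup ra * FreeGroup rw'.
  apply: val_inj => /=; case: w rw {IHw rw'} => [//|b w] /=.
  by case/andP => /negPf ->.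
rewrite phiM IHw; suff -> : phi (FreeGroup ra) = free_lift_letter a by [].
rewrite /free_lift_letter; case: a ra {rw} => x [] ra /=.
  by rewrite -phif -phiV; congr phi; apply: val_inj.
by rewrite -phif; congr phi; apply: val_inj.
Qed.

End UniversalProperty.
End FreeGroup.

HB.mixin Record isLatticeOrderedGroup d T of Group T & Order.Lattice d T := {
  lg_mul2l : forall z x y : T, (x <= y)%O -> (z * x <= z * y)%O;
  lg_mul2r : forall z x y : T, (x <= y)%O -> (x * z <= y * z)%O
}.

#[short(type="lgroupType")]
HB.structure Definition LGroup d :=
  { T of Group T & Order.Lattice d T & isLatticeOrderedGroup d T }.

Definition basic_element d (L : lgroupType d) (x : L) : Prop :=
  (1 < x)%O /\
  total_on [set y : L | (1 <= y)%O && (y <= x)%O] (fun y z => (y <= z)%O).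

Fact lgroup_display : Order.disp_t. Proof. exact: Order.Disp tt tt. Qed.

(* Aut(T, <); the product f * g is f \o g, so that left translations of a group
   compose as g * h |-> g \o h. *)
Section OrderAut.
Variables (d : Order.disp_t) (T : orderType d).

Definition is_order_aut (f : T -> T) : Prop :=
  bijective f /\ {homo f : x y / (x < y)%O}.

Record order_aut : Type :=
  OrderAut { oaut_fun :> T -> T; _ : `[< is_order_aut oaut_fun >] }.

HB.instance Definition _ := [isSub for oaut_fun].
HB.instance Definition _ := [Choice of order_aut by <:].

Implicit Types f g h : order_aut.

Lemma order_autP f : is_order_aut f.
Proof. by case: f => f /= /asboolP. Qed.

Lemma order_aut_ext f g : f =1 g -> f = g.
Proof. by move=> fg; apply: val_inj; apply: funext. Qed.

Lemma oaut_le f : {mono f : x y / (x <= y)%O}.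
Proof. exact/le_mono/(order_autP f).2. Qed.

Definition mk_order_aut (f : T -> T) (fP : is_order_aut f) : order_aut :=
  OrderAut (asboolT fP).

Lemma is_order_aut_can (f f' : T -> T) :
  cancel f f' -> cancel f' f -> {homo f : x y / (x <= y)%O} -> is_order_aut f.
Proof.
move=> fK f'K f_le; split; first by exists f'.
by apply: inj_homo_lt; first exact: can_inj fK.
Qed.

Lemma oaut_inv_subproof f : exists f' : T -> T, cancel f f' /\ cancel f' f.
Proof. by have [[f' fK f'K] _] := order_autP f; exists f'. Qed.

Definition oaut_inv_fun f : T -> T := sval (cid (oaut_inv_subproof f)).

Lemma oautK f : cancel f (oaut_inv_fun f).
Proof. by rewrite /oaut_inv_fun; case: cid => ? []. Qed.

Lemma oautVK f : cancel (oaut_inv_fun f) f.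
Proof. by rewrite /oaut_inv_fun; case: cid => ? []. Qed.

Lemma oautV_le f : {mono oaut_inv_fun f : x y / (x <= y)%O}.
Proof. by move=> x y; rewrite -[LHS](oaut_le f) !oautVK. Qed.

Lemma oaut_one_subproof : is_order_aut id.
Proof. exact: (@is_order_aut_can id id). Qed.

Lemma oaut_mul_subproof f g : is_order_aut (f \o g).
Proof.
apply: (@is_order_aut_can _ (oaut_inv_fun g \o oaut_inv_fun f)) => x /=.
- by rewrite !oautK.
- by rewrite !oautVK.
- by move=> y xy; rewrite !oaut_le.
Qed.

Lemma oaut_inv_is_aut f : is_order_aut (oaut_inv_fun f).
Proof.
apply: (is_order_aut_can (oautVK f) (oautK f)) => x y.
by rewrite oautV_le.
Qed.

Lemma oaut_meet_subproof f g :
  is_order_aut (fun x => Order.min (f x) (g x)).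
Proof.
apply: (@is_order_aut_can _
  (fun x => Order.max (oaut_inv_fun f x) (oaut_inv_fun g x))) => x.
- case: (leP (f x) (g x)) => [fg|/ltW gf]; rewrite oautK.
    by apply/max_idPl; rewrite -(oaut_le g) oautVK.
  by apply/max_idPr; rewrite -(oaut_le f) oautVK.
- case: (leP (oaut_inv_fun f x) (oaut_inv_fun g x)) => [fg|/ltW gf];
    rewrite oautVK.
    by apply/min_idPr; rewrite -{1}(oautVK f x) oaut_le.
  by apply/min_idPl; rewrite -{1}(oautVK g x) oaut_le.
- by move=> y xy; rewrite le_min !ge_min !oaut_le xy orbT.
Qed.

Lemma oaut_join_subproof f g :
  is_order_aut (fun x => Order.max (f x) (g x)).
Proof.
apply: (@is_order_aut_can _
  (fun x => Order.min (oaut_inv_fun f x) (oaut_inv_fun g x))) => x.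
- case: (leP (f x) (g x)) => [fg|/ltW gf]; rewrite oautK.
    by apply/min_idPr; rewrite -(oaut_le f) oautVK.
  by apply/min_idPl; rewrite -(oaut_le g) oautVK.
- case: (leP (oaut_inv_fun f x) (oaut_inv_fun g x)) => [fg|/ltW gf];
    rewrite oautVK.
    by apply/max_idPl; rewrite -{2}(oautVK g x) oaut_le.
  by apply/max_idPr; rewrite -{2}(oautVK f x) oaut_le.
- by move=> y xy; rewrite ge_max !le_max !oaut_le xy orbT.
Qed.

Definition oaut_one : order_aut := mk_order_aut oaut_one_subproof.
Definition oaut_mul f g : order_aut := mk_order_aut (oaut_mul_subproof f g).
Definition oaut_inv f : order_aut := mk_order_aut (oaut_inv_is_aut f).
Definition oaut_meet f g : order_aut := mk_order_aut (oaut_meet_subproof f g).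
Definition oaut_join f g : order_aut := mk_order_aut (oaut_join_subproof f g).

Lemma oaut_mulA : associative oaut_mul.
Proof. by move=> f g h; apply: order_aut_ext. Qed.
Lemma oaut_mul1g : left_id oaut_one oaut_mul.
Proof. by move=> f; apply: order_aut_ext. Qed.
Lemma oaut_mulg1 : right_id oaut_one oaut_mul.
Proof. by move=> f; apply: order_aut_ext. Qed.
Lemma oaut_mulVg : left_inverse oaut_one oaut_inv oaut_mul.
Proof. by move=> f; apply: order_aut_ext => x; apply: oautK. Qed.
Lemma oaut_mulgV : right_inverse oaut_one oaut_inv oaut_mul.
Proof. by move=> f; apply: order_aut_ext => x; apply: oautVK. Qed.

HB.instance Definition _ := isGroup.Build order_aut
  oaut_mulA oaut_mul1g oaut_mulg1 oaut_mulVg oaut_mulgV.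

Lemma oaut_meetC : commutative oaut_meet.
Proof. by move=> f g; apply: order_aut_ext => x; apply: minC. Qed.
Lemma oaut_joinC : commutative oaut_join.
Proof. by move=> f g; apply: order_aut_ext => x; apply: maxC. Qed.
Lemma oaut_meetA : associative oaut_meet.
Proof. by move=> f g h; apply: order_aut_ext => x; apply: minA. Qed.
Lemma oaut_joinA : associative oaut_join.
Proof. by move=> f g h; apply: order_aut_ext => x; apply: maxA. Qed.
Lemma oaut_joinKI g f : oaut_meet f (oaut_join f g) = f.
Proof.
by apply: order_aut_ext => x /=; apply/min_idPl; rewrite le_max lexx.
Qed.
Lemma oaut_meetKU g f : oaut_join f (oaut_meet f g) = f.
Proof.
by apply: order_aut_ext => x /=; apply/max_idPl; rewrite ge_min lexx.
Qed.
Lemma oaut_meetUl : left_distributive oaut_meet oaut_join.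
Proof. by move=> f g h; apply: order_aut_ext => x; apply: min_maxl. Qed.
Lemma oaut_meetxx : idempotent_op oaut_meet.
Proof. by move=> f; apply: order_aut_ext => x; apply: minxx. Qed.

HB.instance Definition _ := Order.isMeetJoinDistrLattice.Build
  lgroup_display order_aut
  (fun _ _ => erefl) (fun _ _ => erefl) oaut_meetC oaut_joinC
  oaut_meetA oaut_joinA oaut_joinKI oaut_meetKU oaut_meetUl oaut_meetxx.

Lemma oaut_leP f g : reflect (forall x, f x <= g x)%O (f <= g)%O.
Proof.
apply: (iffP eqP) => [fg x|fg].
  by rewrite -{1}fg /= ge_min lexx orbT.
by apply: order_aut_ext => x; apply/min_idPl/fg.
Qed.

Lemma oaut_mul2l h f g : (f <= g)%O -> (h * f <= h * g)%O.
Proof.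
by move/oaut_leP=> fg; apply/oaut_leP => x /=; rewrite oaut_le.
Qed.

Lemma oaut_mul2r h f g : (f <= g)%O -> (f * h <= g * h)%O.
Proof. by move/oaut_leP=> fg; apply/oaut_leP => x; apply: fg. Qed.

HB.instance Definition _ := isLatticeOrderedGroup.Build
  lgroup_display order_aut oaut_mul2l oaut_mul2r.

End OrderAut.

Section LGroupProd.
Variables (d : Order.disp_t) (I : Type) (L : I -> lgroupType d).

Definition lgroup_prod : Type := forall i, L i.

HB.instance Definition _ := gen_eqMixin lgroup_prod.
HB.instance Definition _ := gen_choiceMixin lgroup_prod.

Implicit Types x y z : lgroup_prod.

Lemma lgroup_prod_ext x y : (forall i, x i = y i) -> x = y.
Proof. exact: functional_extensionality_dep. Qed.

Definition lprod_one : lgroup_prod := fun=> 1.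
Definition lprod_mul x y : lgroup_prod := fun i => x i * y i.
Definition lprod_inv x : lgroup_prod := fun i => (x i)^-1.
Definition lprod_meet x y : lgroup_prod := fun i => (x i `&` y i)%O.
Definition lprod_join x y : lgroup_prod := fun i => (x i `|` y i)%O.

Lemma lprod_mulA : associative lprod_mul.
Proof. by move=> x y z; apply: lgroup_prod_ext => i; apply: mulgA. Qed.
Lemma lprod_mul1g : left_id lprod_one lprod_mul.
Proof. by move=> x; apply: lgroup_prod_ext => i; apply: mul1g. Qed.
Lemma lprod_mulg1 : right_id lprod_one lprod_mul.
Proof. by move=> x; apply: lgroup_prod_ext => i; apply: mulg1. Qed.
Lemma lprod_mulVg : left_inverse lprod_one lprod_inv lprod_mul.
Proof. by move=> x; apply: lgroup_prod_ext => i; apply: mulVg. Qed.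
Lemma lprod_mulgV : right_inverse lprod_one lprod_inv lprod_mul.
Proof. by move=> x; apply: lgroup_prod_ext => i; apply: mulgV. Qed.

HB.instance Definition _ := isGroup.Build lgroup_prod
  lprod_mulA lprod_mul1g lprod_mulg1 lprod_mulVg lprod_mulgV.

Definition lprod_le x y : bool := lprod_meet x y == x.

Lemma lprod_leP x y : reflect (forall i, x i <= y i)%O (lprod_le x y).
Proof.
apply: (iffP eqP) => [xy i|xy].
  by rewrite leEmeet; apply/eqP; exact: (congr1 (fun z => z i) xy).
by apply: lgroup_prod_ext => i; apply/meet_idPl/xy.
Qed.

Lemma lprod_le_refl : reflexive lprod_le.
Proof. by move=> x; apply/lprod_leP => i; exact: lexx. Qed.
Lemma lprod_le_anti : antisymmetric lprod_le.
Proof.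
move=> x y /andP[/lprod_leP xy /lprod_leP yx].
by apply: lgroup_prod_ext => i; apply: le_anti; rewrite xy yx.
Qed.
Lemma lprod_le_trans : transitive lprod_le.
Proof.
move=> y x z /lprod_leP xy /lprod_leP yz; apply/lprod_leP => i.
exact: le_trans (xy i) (yz i).
Qed.

HB.instance Definition _ := Order.Le_isPOrder.Build lgroup_display lgroup_prod
  lprod_le_refl lprod_le_anti lprod_le_trans.

Lemma lprod_meetC : commutative lprod_meet.
Proof. by move=> x y; apply: lgroup_prod_ext => i; apply: meetC. Qed.
Lemma lprod_joinC : commutative lprod_join.
Proof. by move=> x y; apply: lgroup_prod_ext => i; apply: joinC. Qed.
Lemma lprod_meetA : associative lprod_meet.
Proof. by move=> x y z; apply: lgroup_prod_ext => i; apply: meetA. Qed.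
Lemma lprod_joinA : associative lprod_join.
Proof. by move=> x y z; apply: lgroup_prod_ext => i; apply: joinA. Qed.
Lemma lprod_joinKI y x : lprod_meet x (lprod_join x y) = x.
Proof. by apply: lgroup_prod_ext => i; apply: joinKI. Qed.
Lemma lprod_meetKU y x : lprod_join x (lprod_meet x y) = x.
Proof. by apply: lgroup_prod_ext => i; apply: meetKU. Qed.

HB.instance Definition _ := Order.POrder_isLattice.Build
  lgroup_display lgroup_prod lprod_meetC lprod_joinC lprod_meetA lprod_joinA
  lprod_joinKI lprod_meetKU (fun _ _ => erefl).

Lemma lprod_mul2l z x y : (x <= y)%O -> (z * x <= z * y)%O.
Proof.
by move/lprod_leP=> xy; apply/lprod_leP => i; exact: lg_mul2l (xy i).
Qed.

Lemma lprod_mul2r z x y : (x <= y)%O -> (x * z <= y * z)%O.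
Proof.
by move/lprod_leP=> xy; apply/lprod_leP => i; exact: lg_mul2r (xy i).
Qed.

HB.instance Definition _ := isLatticeOrderedGroup.Build
  lgroup_display lgroup_prod lprod_mul2l lprod_mul2r.

End LGroupProd.

Section GeneratedLGroup.
Variables (d : Order.disp_t) (L : lgroupType d) (S : set L).

Definition lgroup_closed (A : set L) : Prop :=
  [/\ A 1, forall x y, A x -> A y -> A (x * y), forall x, A x -> A x^-1,
      forall x y, A x -> A y -> A (x `&` y)%O
    & forall x y, A x -> A y -> A (x `|` y)%O].

Lemma smallest_lgroup_closed : lgroup_closed (smallest lgroup_closed S).
Proof.
split=> [A [[]]|x y xS yS A AP|x xS A AP|x y xS yS A AP|x y xS yS A AP] //;
  case: (AP) => -[A1 AM AV AI AU] _.
- by apply: AM; [exact: xS | exact: yS].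
- by apply: AV; exact: xS.
- by apply: AI; [exact: xS | exact: yS].
- by apply: AU; [exact: xS | exact: yS].
Qed.

Record generated_lgroup : Type := GeneratedLGroup {
  generated_val : L;
  _ : generated_val \in smallest lgroup_closed S }.

HB.instance Definition _ := [isSub for generated_val].
HB.instance Definition _ := [Choice of generated_lgroup by <:].

Let pS : pred L := fun x => x \in smallest lgroup_closed S.

Lemma generated_group_closed : group_closed pS.
Proof.
have [S1 SM SV _ _] := smallest_lgroup_closed.
split; first exact/mem_set.
by move=> x y /set_mem xS /set_mem yS; exact: mem_set (SM _ _ xS (SV _ yS)).
Qed.

Lemma generated_meet_closed : meet_closed pS.
Proof.
have [_ _ _ SI _] := smallest_lgroup_closed.
by move=> x y /set_mem xS /set_mem yS; exact: mem_set (SI _ _ xS yS).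
Qed.

Lemma generated_join_closed : join_closed pS.
Proof.
have [_ _ _ _ SU] := smallest_lgroup_closed.
by move=> x y /set_mem xS /set_mem yS; exact: mem_set (SU _ _ xS yS).
Qed.

HB.instance Definition _ := SubChoice_isSubGroup.Build L pS generated_lgroup
  generated_group_closed.

HB.instance Definition _ := Order.SubChoice_isSubLattice.Build
  d L pS lgroup_display generated_lgroup
  generated_meet_closed generated_join_closed.

Implicit Types x y z : generated_lgroup.

Lemma generated_mul2l z x y : (x <= y)%O -> (z * x <= z * y)%O.
Proof. by rewrite -!Order.le_val !valM; apply: lg_mul2l. Qed.

Lemma generated_mul2r z x y : (x <= y)%O -> (x * z <= y * z)%O.
Proof. by rewrite -!Order.le_val !valM; apply: lg_mul2r. Qed.

HB.instance Definition _ := isLatticeOrderedGroup.Build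
  lgroup_display generated_lgroup generated_mul2l generated_mul2r.

End GeneratedLGroup.

Section LeftOrders.
Variable G : groupType.

Definition positive_cone (P : set G) : Prop :=
  let PV := [set g^-1 | g in P] in
  [/\ forall g h, P g -> P h -> P (g * h),
      P `|` PV `|` [set 1] = setT,
      P `&` PV = set0, P `&` [set 1] = set0 & PV `&` [set 1] = set0].

Record LO : Type := LeftOrder { cone : set G; _ : `[< positive_cone cone >] }.

HB.instance Definition _ := [isSub for cone].
HB.instance Definition _ := [Choice of LO by <:].

HB.instance Definition _ := @isSubBaseTopological.Build LO (set LO)
  (range (fun g : G => [set P : LO | cone P g])) id.

Lemma coneP (P : LO) : positive_cone (cone P).
Proof. by case: P => P /= /asboolP. Qed.

(* An alias of G carrying the total order <_P *)
Definition lo_carrier (P : LO) : Type := G.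

Section LeftOrder.
Variable P : LO.
Local Notation T := (lo_carrier P).

HB.instance Definition _ := Choice.copy T G.

Definition lo_lt (g h : T) : bool := `[< cone P ((g : G)^-1 * h) >].
Definition lo_le (g h : T) : bool := (g == h) || lo_lt g h.
Definition lo_min (g h : T) : T := if lo_lt g h then g else h.
Definition lo_max (g h : T) : T := if lo_lt g h then h else g.

Lemma lo_lt_irr : irreflexive lo_lt.
Proof.
move=> g; apply/asboolP; rewrite mulVg => P1.
have [_ _ _ P1N _] := coneP P.
by have : (cone P `&` [set 1]) 1 by []; rewrite P1N.
Qed.

Lemma lo_lt_trans : transitive lo_lt.
Proof.
have [PM _ _ _ _] := coneP P.
move=> h g k /asboolP gh /asboolP hk; apply/asboolP.
by have := PM _ _ gh hk; rewrite mulgA mulgK.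
Qed.

Lemma lo_lt_total g h : g != h -> lo_lt g h || lo_lt h g.
Proof.
have [_ PT _ _ _] := coneP P => /eqP gNh.
have : [set: G] ((g : G)^-1 * h) by [].
rewrite -PT => -[[gh|[k Pk kE]]|/= gh1].
- by apply/orP; left; apply/asboolP.
- apply/orP; right; apply/asboolP.
  by rewrite -[X in cone P X]invgK invgM invgK -kE invgK.
- by case: gNh; rewrite -[g]mulg1 -gh1 mulVKg.
Qed.

HB.instance Definition _ := Order.LtOrder.Build lgroup_display T
  (fun _ _ => erefl : lo_le _ _ = _) (fun _ _ => erefl : lo_min _ _ = _)
  (fun _ _ => erefl : lo_max _ _ = _) lo_lt_irr lo_lt_trans lo_lt_total.

Lemma lo_translation_subproof (g : G) : is_order_aut (fun h : T => g * h : T).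
Proof.
split; first by exists (fun h : T => g^-1 * h); [exact: mulKg | exact: mulVKg].
move=> h k /asboolP hk; apply/asboolP.
by rewrite invgM -mulgA mulKg.
Qed.

Definition lo_translation (g : G) : order_aut T :=
  mk_order_aut (lo_translation_subproof g).

End LeftOrder.

Definition lo_embedding (g : G) :
    lgroup_prod (fun P : LO => order_aut (lo_carrier P)) :=
  fun P => lo_translation P g.

Definition free_lgroup : Type := generated_lgroup (range lo_embedding).

HB.instance Definition _ := LGroup.on free_lgroup.

End LeftOrders.

(* Main.v *)
Require Import Defs.
From mathcomp Require Import all_boot all_order all_algebra.
From mathcomp Require Import finmap boolp classical_sets topology.
Set Implicit Arguments.
Unset Strict Implicit.
Unset Printing Implicit Defensive.

Import Order.TTheory GRing.Theory Num.Theory.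

(** A neighbourhood of a left order [P] of the free group [F] is given by
finitely many [P]-positive elements [W], so it suffices to find two different
left orders that make all of [W] positive ([two_orders_near]).

A left order is recovered from an action of [F] on a totally ordered set with
a base point: [g] is positive when it moves the base point up, and a fixed left
order of [F] decides the elements that fix it ([dynamical_coneP]).  When the
stabilizer of the base point is nontrivial, breaking ties by a left order or by
its opposite gives different orders.  So the point is to find an action that
moves the base point up under every element of [W], and yet has a nontrivial
stabilizer.

Let [S] be a finite set of elements that contains [W] and is closed under
taking suffixes of reduced words; ordered by [P], it embeds into the rationals,
and left multiplication by each generator is a finite increasing partial map of
[S].  Since [F] is free, any choice of increasing bijections of the rationals
extending these partial maps defines an action of [F], and suffix-closedness
makes the orbit of the base point [1] follow [S] ([action_trajectory]); in
particular [W] is positive.  There is room to create a stabilizer: given a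
maximum [x] of [S] and a generator [a], one of [a x], [a^-1 x] is a new, larger
element [m], which becomes the maximum after it is added to [S].  As [m] is a
leaf, another generator [b] has no constraint at [m], neither for images nor
for preimages, and because everything else lies below [m] it may be required
to fix [m] ([suffix_closed_free_maximum], [perturbed_action]).  Then
[m^-1 b m] fixes the base point.

For the lattice-ordered group, the value at [h] of the [P]-component of an
element of [F(G)] is a locally constant function of [P]
([free_lgroup_locally_constant]), because the lattice operations only compare
finitely many elements.  An element [x] above 1 moves some [h] up for some [P],
hence also for some other nearby order [Q]; an element [g] positive for [P] and
negative for [Q] then yields two incomparable elements between 1 and [x]
([not_basic_of_not_isolated]). *)

Local Open Scope classical_set_scope.

(** * Finite increasing partial maps of the rationals *)

Section Extension.

Lemma glue_order_aut (d : Order.disp_t) (T : orderType d) (f g : order_aut T)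
    (c : T) : f c = g c ->
  exists h : order_aut T,
    (forall t, (t <= c)%O -> h t = f t) /\ (forall t, (c <= t)%O -> h t = g t).
Proof.
move=> fgc.
pose h t := if (t <= c)%O then f t else g t.
pose h' t :=
  if (t <= f c)%O then oaut_inv_fun f t else oaut_inv_fun g t.
have hP : is_order_aut h.
  apply: (@is_order_aut_can _ _ _ h') => t.
  - rewrite /h /h'. case: (leP t c) => tc; first by rewrite oaut_le tc oautK.
    by rewrite fgc oaut_le leNgt tc oautK.
  - rewrite /h' /h; case: (leP t (f c)) => tc.
      by rewrite -(oaut_le f) oautVK tc.
    by rewrite -(oaut_le g) oautVK -fgc leNgt tc.
  - move=> u tu; rewrite /h; case: (leP t c) => tc; case: (leP u c) => uc.
    + by rewrite oaut_le.
    + apply: (@le_trans _ _ (f c)); first by rewrite oaut_le.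
      by rewrite fgc oaut_le ltW.
    + by move: (le_trans tu uc); rewrite leNgt tc.
    + by rewrite oaut_le.
exists (mk_order_aut hP); split=> t tc /=; rewrite /h; first by rewrite tc.
by case: (leP t c) => // tc'; have -> : t = c by apply/le_anti; rewrite tc tc'.
Qed.

Lemma affine_order_aut (x y u v : rat) : (x < y)%R -> (u < v)%R ->
  exists f : order_aut rat, f x = u /\ f y = v.
Proof.
move=> xy uv; pose s := ((v - u) / (y - x))%R.
have s_gt0 : (0 < s)%R by rewrite divr_gt0 ?subr_gt0.
have sN0 : (s != 0)%R by rewrite gt_eqF.
have fP : is_order_aut (fun t : rat => s * (t - x) + u)%R.
  apply: (@is_order_aut_can _ _ _ (fun t => (t - u) / s + x)%R) => t.
  - by rewrite addrK mulrC mulKf // subrK.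
  - by rewrite addrK mulrC mulfVK // subrK.
  - by move=> t' tt'; rewrite lerD2r ler_pM2l // lerD2r.
exists (mk_order_aut fP) => /=; rewrite subrr mulr0 add0r.
by split=> //; rewrite /s divfK ?subrK // subr_eq0 gt_eqF.
Qed.

(** The partial map is presented by two increasing labellings [p] and [q] of its
domain, rather than by a set of pairs of rationals, so that the order on the
labels alone controls both sides. *)
Lemma extend_to_order_aut (d : Order.disp_t) (T : orderType d) (D : seq T)
    (p q : T -> rat) :
    {in D &, {homo p : t u / (t < u)%O}} ->
    {in D &, {homo q : t u / (t < u)%O}} ->
  exists f : order_aut rat, {in D, forall t, f (p t) = q t}.
Proof.
wlog sD : D / sorted <%O D => [hwlog|].
  have mD : sort <=%O (undup D) =i D by move=> t; rewrite mem_sort mem_undup.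
  move=> pD qD; case: (hwlog (sort <=%O (undup D))).
  - by rewrite sort_lt_sorted undup_uniq.
  - by move=> t u; rewrite !mD; apply: pD.
  - by move=> t u; rewrite !mD; apply: qD.
  - by move=> f fP; exists f => t; rewrite -mD; apply: fP.
elim: D sD => [|t [|u D] IHD]; first by move=> _ _ _; exists (@oaut_one _ rat).
  move=> _ _ _.
  (* One prescribed value: any second point completes it to an affine map. *)
  have [f [fE _]] : exists f : order_aut rat,
      f (p t) = q t /\ f (p t + 1)%R = (q t + 1)%R.
    by apply: affine_order_aut; rewrite ltrDl.
  by exists f => v; rewrite inE => /eqP ->.
rewrite [sorted _ _]/= => /andP[tu sD] pD qD.
have [||f fP] := IHD sD.
- by move=> v w vD wD; apply: pD; rewrite inE ?vD ?wD orbT.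
- by move=> v w vD wD; apply: qD; rewrite inE ?vD ?wD orbT.
have tD : t \in t :: u :: D by rewrite inE eqxx.
have uD : u \in t :: u :: D by rewrite !inE eqxx orbT.
have [g [gt gu]] := affine_order_aut (pD _ _ tD uD tu) (qD _ _ tD uD tu).
have [|h [hg hf]] := @glue_order_aut _ rat g f (p u).
  by rewrite gu fP // inE eqxx.
exists h => v; rewrite inE => /orP[/eqP ->|vD].
  by rewrite hg // ltW // pD.
rewrite hf ?fP //.
case: (eqVneq v u) => [->//|vu]; apply/ltW/pD => //.
  by rewrite inE vD orbT.
move: vD; rewrite inE (negPf vu) /= => vD.
by have /allP := order_path_min lt_trans sD; apply.
Qed.

End Extension.

(** * Left orders and their topology *)

Section LeftOrderFacts.
Variable G : groupType.
Local Open Scope group_scope.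
Implicit Types (P Q : LO G) (g h : G).

Lemma positive_coneI (C : set G) :
    (forall g h, C g -> C h -> C (g * h)) -> ~ C 1 ->
    (forall g, g != 1 -> C g \/ C g^-1) ->
  positive_cone C.
Proof.
move=> CM C1 CT; split=> //.
- apply/seteqP; split=> // g _.
  have [->|/CT[Cg|Cg]] := eqVneq g 1; [by right | by left; left |].
  by left; right; exists g^-1 => //; rewrite invgK.
- apply/seteqP; split=> // g [Cg [h Ch hg]].
  by apply: C1; rewrite -(mulVg h) hg; apply: CM.
- by apply/seteqP; split=> // g /= [Cg g1]; apply: C1; rewrite -g1.
- apply/seteqP; split=> // g /= [[h Ch hg] g1]; apply: C1.
  by rewrite -invg1 -g1 -hg invgK.
Qed.

Lemma coneM P g h : cone P g -> cone P h -> cone P (g * h).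
Proof. by have [PM _ _ _ _] := coneP P; apply: PM. Qed.

Lemma cone1 P : ~ cone P 1.
Proof.
have [_ _ _ P1N _] := coneP P => P1.
by have : (cone P `&` [set 1]) 1 by []; rewrite P1N.
Qed.

Lemma cone_total P g : g != 1 -> cone P g \/ cone P g^-1.
Proof.
move=> /eqP g1; have [_ PT _ _ _] := coneP P.
have : [set: G] g by []; rewrite -PT => -[[|[h Ph <-]]|//]; first by left.
by right; rewrite invgK.
Qed.

Lemma coneV P g : cone P g -> ~ cone P g^-1.
Proof.
by move=> Pg PgV; apply: (@cone1 P); rewrite -(mulgV g); apply: coneM.
Qed.

Lemma lo_ltE P g h : ((g : lo_carrier P) < h)%O = `[< cone P (g^-1 * h) >].
Proof. by []. Qed.

Lemma cone_lt1 P g : cone P g -> ((1 : lo_carrier P) < g)%O.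
Proof. by move=> Pg; rewrite lo_ltE invg1 mul1g; apply/asboolP. Qed.

Definition mk_LO (C : set G) (CP : positive_cone C) : LO G :=
  LeftOrder (asboolT CP).

Lemma opposite_cone P : positive_cone [set g | cone P g^-1].
Proof.
apply: positive_coneI => /= [g h Pg Ph||g g1].
- by rewrite invgM; apply: coneM.
- by rewrite invg1; apply: cone1.
- by rewrite invgK; have [] := cone_total P g1; [right|left].
Qed.

Lemma nbhs_cone P g : cone P g -> nbhs P [set Q | cone Q g].
Proof.
move=> Pg; apply: open_nbhs_nbhs; split=> //.
exists [set [set Q | cone Q g]]; last by rewrite bigcup_set1.
move=> _ ->.
apply: (@finI_from1 _ _ (range (fun h => [set Q : LO G | cone Q h])) id).
by exists g.
Qed.

(** The converse of [nbhs_cone]: cylinders over finite sets of positive elements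
form a neighbourhood basis, since the subbasic sets already include the
conditions that an element be negative. *)
Lemma nbhs_LOP P (V : set (LO G)) : nbhs P V ->
  exists2 W : seq G, (forall g, g \in W -> cone P g) &
    forall Q, (forall g, g \in W -> cone Q g) -> V Q.
Proof.
rewrite nbhsE => -[U [oU UP] UV].
have [B BfinI BU] : exists2 B,
    B `<=` finI_from (range (fun g => [set Q : LO G | cone Q g])) id &
    \bigcup_(E in B) E = U by exact: oU.
move: UP; rewrite -BU => -[C BC CP].
have [D DS DC] := BfinI _ BC.
have /choice[c cP] : forall E : set (LO G), exists g,
    E \in D -> E = [set Q | cone Q g].
  move=> E; case: (boolP (E \in D)) => [/DS/set_mem[g _ <-]|_].
    by exists g.
  by exists 1.
exists [seq c E | E <- D] => [_ /mapP[E SD ->]|Q QW].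
  by move: CP; rewrite -DC => /(_ E SD) /=; rewrite [X in X P]cP.
apply/UV; rewrite -BU; exists C => //; rewrite -DC => E /= SD.
by rewrite [E]cP //=; apply: QW; apply/mapP; exists E.
Qed.
End LeftOrderFacts.
(** * The left order of a based action *)

Section DynamicalCone.
Local Open Scope group_scope.
Variables (G : groupType) (d : Order.disp_t) (T : orderType d).
Variables (A : G -> order_aut T) (AM : {morph A : g h / g * h}).
Variables (x : T) (R : LO G).

Lemma action1 t : A 1 t = t.
Proof.
by have -> : A 1 = 1 by apply: (@mulgI _ (A 1)); rewrite -AM !mulg1.
Qed.

Lemma actionM g h t : A (g * h) t = A g (A h t).
Proof. by rewrite AM. Qed.

Lemma actionK g : cancel (A g) (A g^-1).
Proof. by move=> t; rewrite -actionM mulVg action1. Qed.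

Definition dynamical_cone : set G :=
  [set g | (x < A g x)%O \/ A g x = x /\ cone R g].

(** The elements that move [x] up form a semigroup, stable under multiplication
by the stabilizer of [x] on both sides, and the elements that move [x] down are
their inverses; [R] only has to order the stabilizer. *)
Lemma dynamical_coneP : positive_cone dynamical_cone.
Proof.
apply: positive_coneI => [g h|[]|g g1].
- rewrite /dynamical_cone /= actionM => -[xg|[gx Rg]] [xh|[hx Rh]].
  + by left; apply: lt_trans xg _; rewrite (leW_mono (oaut_le (A g))).
  + by left; rewrite hx.
  + by left; rewrite -{1}gx (leW_mono (oaut_le (A g))).
  + by right; rewrite hx; split=> //; apply: coneM.
- by rewrite action1 ltxx.
- by case=> _; apply: cone1.
- rewrite /dynamical_cone /=; case: (ltgtP x (A g x)) => [xg|gx|gx].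
  + by left; left.
  + by right; left; rewrite -{1}(actionK g x) (leW_mono (oaut_le (A g^-1))).
  + have gVx : A g^-1 x = x by rewrite {1}gx actionK.
    by have [Rg|Rg] := cone_total R g1; [left|right]; right.
Qed.

End DynamicalCone.

(** * Finite totally ordered sets *)

(** Rank in a finite set [S] embeds [S] into the integers. *)
Lemma count_below_lt (d : Order.disp_t) (T : orderType d) (S : seq T)
    (s t : T) :
  s \in S -> (s < t)%O -> (count (< s)%O S < count (< t)%O S)%N.
Proof.
move=> sS st.
have sub : subpred (< s)%O (< t)%O by move=> u /= us; apply: lt_trans us st.
elim: S sS => //= u S IHS; rewrite inE => /orP[/eqP <-|/IHS lt_S].
  by rewrite ltxx st add0n add1n ltnS sub_count.
rewrite -addnS leq_add //.
by case: (ltP u s) => // /sub /= ->.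
Qed.

Lemma exists_max_seq (d : Order.disp_t) (T : orderType d) (S : seq T) (s : T) :
  s \in S -> exists2 x, x \in S & forall t, t \in S -> (t <= x)%O.
Proof.
elim: S s => // u [_ s _|v S IHS s _].
  by exists u => [|t]; rewrite inE // => /eqP ->.
have [|x xS x_max] := IHS v; first exact: mem_head.
exists (Order.max u x).
  by case: leP => _; rewrite !inE ?eqxx //; rewrite inE in xS; rewrite xS orbT.
move=> t; rewrite inE => /orP[/eqP ->|/x_max tx]; rewrite le_max ?lexx //.
by rewrite tx orbT.
Qed.

(** * Reduced words and suffix-closed sets *)

Section FreeGroupWords.
Variable X : choiceType.
Local Notation F := (free_group X).
Local Open Scope group_scope.

Definition free_letter (l : X * bool) : F := FreeGroup (isT : reduced [:: l]).

Lemma free_letterE l :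
  free_letter l = if l.2 then (free_gen l.1)^-1 else free_gen l.1.
Proof. by apply: val_inj; case: l => x []. Qed.

Lemma word_cons l (g h : F) : word g = l :: word h -> g = free_letter l * h.
Proof.
case: h => w rw /= gE; apply: val_inj => /=; rewrite gE.
move: (word_reduced g); rewrite gE; case: w {rw gE} => [//|m w] /=.
by case/andP=> /negPf ->.
Qed.

Lemma word_letterM l (g : F) :
  word (free_letter l * g) = l :: word g \/
  word g = inv_letter l :: word (free_letter l * g).
Proof.
case: g => w rw /=; case: w rw => [|m w] rw /=; first by left.
by case: eqVneq => [<-|_]; [right|left].
Qed.

Lemma word_ind (K : F -> Prop) :
  K 1 -> (forall l g h, word g = l :: word h -> K h -> K g) -> forall g, K g.
Proof.
move=> K1 KS [w]; elim: w => [|l w IHw] rw; last first.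
  have rw' : reduced w by exact: path_sorted rw.
  by apply: (KS l _ (FreeGroup rw')) => //; exact: IHw.
by have -> : FreeGroup rw = 1 by apply: val_inj.
Qed.

Definition suffix_closed (S : seq F) : Prop :=
  forall l g h, word g = l :: word h -> g \in S -> h \in S.

Lemma suffix_closure (W : seq F) :
  exists S, [/\ suffix_closed S, 1 \in S & {subset W <= S}].
Proof.
elim: W => [|g W [S [Scl S1 WS]]].
  exists [:: 1]; split=> // l g h gE.
  by rewrite inE => /eqP g1; rewrite g1 in gE.
have [Sg [Sgcl gSg]] : exists Sg, suffix_closed Sg /\ g \in Sg.
  elim/word_ind: g => [|l g h gE [Sh [Shcl hSh]]].
    exists [:: 1]; split=> [l g h gE|]; last exact: mem_head.
    by rewrite inE => /eqP g1; rewrite g1 in gE.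
  exists (g :: Sh); split=> [m u v uE|]; last exact: mem_head.
  rewrite !inE => /orP[/eqP ug|/(Shcl _ _ _ uE) ->]; last by rewrite orbT.
  move: uE; rewrite ug gE => -[_ /val_inj <-]; by rewrite hSh orbT.
exists (Sg ++ S); split.
- move=> l u v uE; rewrite !mem_cat => /orP[/(Sgcl _ _ _ uE) ->//|].
  by move/(Scl _ _ _ uE) ->; rewrite orbT.
- by rewrite mem_cat S1 orbT.
- by move=> u; rewrite inE mem_cat => /orP[/eqP ->|/WS ->]; rewrite ?gSg ?orbT.
Qed.

(** Reading a reduced word from the right, every intermediate position of the
base point is labelled by a suffix, so conditions on the generators inside [S]
determine the whole trajectory.  An inverse letter from [h] to [g] is the edge
from [g] to [h] of the generator, read backwards. *)
Lemma action_trajectory (d : Order.disp_t) (T : orderType d)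
    (A : F -> order_aut T) (AM : {morph A : g h / g * h})
    (S : seq F) (rho : F -> T) :
    suffix_closed S ->
    (forall x t, t \in S -> free_gen x * t \in S ->
       A (free_gen x) (rho t) = rho (free_gen x * t)) ->
  forall g, g \in S -> A g (rho 1) = rho g.
Proof.
move=> Scl Arho; elim/word_ind => [|l g h gE IHh] gS; first exact: action1.
have hS := Scl _ _ _ gE gS.
have gE' := word_cons gE; rewrite gE' actionM // IHh //.
rewrite free_letterE in gE' *; case: l.2 gE' => gE'.
  have hE : h = free_gen l.1 * g by rewrite gE' mulVKg.
  by rewrite -gE' hE -Arho -?hE // actionK.
by rewrite Arho -?gE'.
Qed.

End FreeGroupWords.

(** * Perturbing a left order of a free group *)

Section Perturbation.
Variables (X : choiceType) (a b : X) (ab : a != b).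
Local Notation F := (free_group X).
Local Open Scope group_scope.

Lemma conj_gen_neq1 c (g : F) : g^-1 * free_gen c * g != 1.
Proof.
rewrite -mulgA -(inj_eq (@mulgI _ g)) mulVKg mulg1.
rewrite -(inj_eq (@mulIg _ g^-1)) mulgK mulgV.
by apply/eqP => /(congr1 (@word X)).
Qed.

(** The new maximum [m = l x] is a leaf of the part of the Cayley graph spanned
by [S]: its word starts with the letter [l], so a neighbour of [m] through
another generator [b] has [m] as a proper suffix and cannot belong to a
suffix-closed set that did not contain [m]. The letter [l] exists because one of
[a x] and [a^-1 x] exceeds [x], according to the sign of [x^-1 a x]. *)
Lemma suffix_closed_free_maximum (P : LO F) (W : seq F) :
  exists S (m : F),
  [/\ suffix_closed S, 1 \in S, {subset W <= S}, m \in S &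
   [/\ forall t, t \in S -> ((t : lo_carrier P) <= m)%O,
       free_gen b * m \notin S & (free_gen b)^-1 * m \notin S]].
Proof.
have [S [Scl S1 WS]] := suffix_closure W.
have [x xS x_max] := @exists_max_seq _ (lo_carrier P) S 1 S1.
have [l la xl] : exists2 l : X * bool,
    l.1 = a & ((x : lo_carrier P) < (free_letter l * x : F))%O.
  case/(cone_total P): (conj_gen_neq1 a (x : F)) => Px;
    [exists (a, false) | exists (a, true)] => //;
    rewrite lo_ltE free_letterE /= mulgA; first exact/asboolP.
  by apply/asboolP; move: Px; rewrite !invgM invgK mulgA.
pose m : F := free_letter l * (x : F).
have mS : m \notin S by apply/negP => /x_max; rewrite leNgt xl.
have mE : word m = l :: word (x : F).
  case: (word_letterM l (x : F)) => // xE.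
  by case/negP: mS; apply: Scl xE xS.
have bmS k : k.1 = b -> free_letter k * m \notin m :: S.
  move=> kb; have kmE : word (free_letter k * m) = k :: word m.
    case: (word_letterM k m) => //; rewrite mE => -[lk].
    by move: ab; rewrite -la -kb lk eqxx.
  rewrite inE negb_or; apply/andP; split.
    by apply/eqP => kmm; have := congr1 size kmE; rewrite kmm => /n_Sn.
  by apply: contra mS => /(Scl _ _ _ kmE).
exists (m :: S), m; split.
- move=> k g h gE; rewrite !inE => /orP[/eqP gm|/(Scl _ _ _ gE) ->].
    move: gE; rewrite gm mE => -[_ /val_inj <-]; by rewrite xS orbT.
  by rewrite orbT.
- by rewrite inE S1 orbT.
- by move=> g /WS gS; rewrite inE gS orbT.
- exact: mem_head.
- split.
  + move=> t; rewrite inE => /orP[/eqP -> //|/x_max tx].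
    by apply: le_trans tx (ltW xl).
  + by have := bmS (b, false) erefl; rewrite free_letterE.
  + by have := bmS (b, true) erefl; rewrite free_letterE.
Qed.

(** Left multiplication by a generator preserves the order of [P], so it is an
increasing partial map of [S]; the extra requirement that [b] fix the maximum
[m] keeps it increasing because [b] maps no element of [S] to [m] and all its
other values lie below [m].  The labelling [rho] is the rank in [S]. *)
Lemma perturbed_action (P : LO F) (S : seq F) (m : F) :
    m \in S -> (forall t, t \in S -> ((t : lo_carrier P) <= m)%O) ->
    free_gen b * m \notin S -> (free_gen b)^-1 * m \notin S ->
  exists (A : F -> order_aut rat) (rho : F -> rat),
  [/\ {morph A : g h / g * h},
      forall s t, s \in S -> ((s : lo_carrier P) < t)%O -> (rho s < rho t)%O,
      A (free_gen b) (rho m) = rho m &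
      forall x t, t \in S -> free_gen x * t \in S ->
        A (free_gen x) (rho t) = rho (free_gen x * t)].
Proof.
move=> mS m_max bmS bVmS.
pose rho (t : F) : rat :=
  (count (fun s => (s < (t : lo_carrier P))%O) (S : seq (lo_carrier P)))%:R%R.
have rho_lt s t :
    s \in S -> ((s : lo_carrier P) < t)%O -> (rho s < rho t)%O.
  by move=> sS st; rewrite /rho ltr_nat;
    apply: (@count_below_lt _ (lo_carrier P)).
have fP x : exists f : order_aut rat,
    (x = b -> f (rho m) = rho m) /\
    (forall t, t \in S -> free_gen x * t \in S ->
       f (rho t) = rho (free_gen x * t)).
  pose loop (t : F) := (x == b) && (t == m).
  pose img (t : F) : F := if loop t then t else free_gen x * t.
  pose D := [seq t <- S | loop t || (free_gen x * t \in S)].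
  have [||f fD] := @extend_to_order_aut _ (lo_carrier P) D rho (rho \o img).
  - move=> s t; rewrite mem_filter => /andP[_ sS] _; exact: rho_lt.
  - move=> s t; rewrite !mem_filter => /andP[sD sS] /andP[tD tS] st.
    rewrite /= /img; case: ifP sD => [/andP[/eqP _ /eqP sm]|sl] /= xsS.
      by move: st; rewrite sm ltNge m_max.
    case: ifP tD => [/andP[/eqP xb /eqP tm]|tl] /= xtS.
      apply: rho_lt => //; rewrite tm lt_neqAle m_max // andbT.
      apply/eqP => xsm; move: bVmS; rewrite -[X in _ * X]xsm xb mulKg.
      by rewrite sS.
    apply: rho_lt => //; move: st; rewrite !lo_ltE.
    by rewrite invgM -mulgA mulKg.
  exists f; split=> [xb|t tS xtS].
    have lm : loop m by rewrite /loop xb !eqxx.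
    by rewrite fD ?mem_filter ?lm //= /img lm.
  have lt : loop t = false.
    apply/negP => /andP[/eqP xb /eqP tm]; move: xtS.
    by rewrite xb tm (negPf bmS).
  by rewrite fD ?mem_filter ?xtS ?orbT //= /img lt.
have [f fE] := choice fP.
exists (free_lift f), rho; split=> //.
- exact: free_liftM.
- by rewrite free_lift_gen; apply: (fE b).1.
- by move=> x t tS xtS; rewrite free_lift_gen; apply: (fE x).2.
Qed.

(** The element [m^-1 b m] follows the loop at [m] and returns to the base
point, so its sign is whatever the order used to break ties says: the two orders
break ties by [P] and by the opposite of [P]. *)
Lemma two_orders_near (P : LO F) (W : seq F) :
    (forall g, g \in W -> cone P g) ->
  exists Q1 Q2 : LO F, [/\ Q1 <> Q2, forall g, g \in W -> cone Q1 g &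
    forall g, g \in W -> cone Q2 g].
Proof.
move=> WP.
have [S [m [Scl S1 WS mS [m_max bmS bVmS]]]] := suffix_closed_free_maximum P W.
have [A [rho [AM rho_lt Abm Arho]]] := perturbed_action mS m_max bmS bVmS.
have Atraj := action_trajectory AM Scl Arho.
pose Q R := mk_LO (dynamical_coneP AM (rho 1) R).
have WQ R g : g \in W -> cone (Q R) g.
  move=> gW; left; rewrite Atraj ?WS //; apply: rho_lt => //.
  exact: cone_lt1 (WP _ gW).
pose P' := mk_LO (opposite_cone P).
exists (Q P), (Q P'); split; [|exact: WQ|exact: WQ].
pose w := m^-1 * free_gen b * m.
have Aw : A w (rho 1) = rho 1.
  by rewrite /w !actionM // Atraj // Abm -(Atraj _ mS) actionK.
have w1 : w != 1 by exact: conj_gen_neq1.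
have Qw R : cone (Q R) w <-> cone R w.
  split=> [[|[]//]|Rw]; first by rewrite Aw ltxx.
  by right.
move=> QQ; have [Pw|Pw] := cone_total P w1.
  have : cone (Q P') w by rewrite -QQ Qw.
  by rewrite Qw /=; apply: coneV.
have : cone (Q P) w by rewrite QQ Qw.
by rewrite Qw => /coneV.
Qed.

Lemma LO_free_group_not_isolated : isolated [set: LO F] = set0.
Proof.
apply/seteqP; split=> // P [_ [V VP VE]].
have [W WP WV] := nbhs_LOP VP.
have [Q1 [Q2 [Q12 WQ1 WQ2]]] := two_orders_near WP.
have VEQ Q : V Q -> Q = P.
  by move=> VQ; have : (V `&` setT) Q by []; rewrite VE.
apply: Q12; exact: etrans (VEQ _ (WV _ WQ1)) (esym (VEQ _ (WV _ WQ2))).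
Qed.

End Perturbation.
(** * Basic elements of the free lattice-ordered group *)

Section NoBasicElement.
Variable G : groupType.
Local Open Scope group_scope.
Implicit Types (P Q : LO G) (g h k : G).
Local Notation prodAut :=
  (lgroup_prod (fun Q : LO G => order_aut (lo_carrier Q))).

Lemma near_lo_lt P g h :
  nbhs P [set Q : LO G | @lo_lt G Q g h = @lo_lt G P g h].
Proof.
have [->|gh] := eqVneq g h.
  by apply: filterE => Q /=; rewrite !lo_lt_irr.
have /(cone_total P) : g^-1 * h != 1.
  by rewrite -(inj_eq (@mulgI _ g)) mulVKg mulg1 eq_sym.
case=> gh_pos; apply: filterS (nbhs_cone gh_pos) => Q Qgh; rewrite /= /lo_lt.
  by rewrite !asboolT.
by rewrite !asboolF // => /coneV; apply.
Qed.

(** All the ordered sets [lo_carrier Q] have the same carrier [G], which makes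
the images of [h] comparable as [Q] varies. *)
Definition orbit_map (z : prodAut) h (Q : LO G) : G := z Q h.

Definition orbits_locally_constant (z : prodAut) : Prop :=
  forall h P, nbhs P [set Q | orbit_map z h Q = orbit_map z h P].

(** Whether [g] is below [h] is decided by the sign of a single element, a
locally constant condition; hence so is the choice made by a minimum or a
maximum. *)
Lemma orbits_locally_constant_closed : lgroup_closed orbits_locally_constant.
Proof.
split=> [h P|x y xC yC h P|x xC h P|x y xC yC h P|x y xC yC h P].
- exact: filterE.
- apply: filterS2 (yC h P) (xC (orbit_map y h P) P) => Q /= yQ xQ.
  by rewrite -[RHS]xQ -yQ.
- apply: filterS (xC (orbit_map x^-1 h P) P) => Q /= xQ.
  rewrite /orbit_map; apply: (can_inj (oautK (x Q))).
  by rewrite [LHS](oautVK (x Q)) [RHS]xQ [RHS](oautVK (x P)).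
- apply: filterS3 (xC h P) (yC h P)
    (near_lo_lt P (orbit_map x h P) (orbit_map y h P)) => Q /= xQ yQ ltQ.
  rewrite -[RHS]/(if lo_lt (orbit_map x h P : lo_carrier P) (orbit_map y h P)
    then orbit_map x h P else orbit_map y h P).
  by rewrite -ltQ -xQ -yQ.
- apply: filterS3 (xC h P) (yC h P)
    (near_lo_lt P (orbit_map x h P) (orbit_map y h P)) => Q /= xQ yQ ltQ.
  rewrite -[RHS]/(if lo_lt (orbit_map x h P : lo_carrier P) (orbit_map y h P)
    then orbit_map y h P else orbit_map x h P).
  by rewrite -ltQ -xQ -yQ.
Qed.

Lemma free_lgroup_locally_constant (z : free_lgroup G) :
  orbits_locally_constant (val z).
Proof.
have /set_mem : val z \in
    smallest (@lgroup_closed _ _) (range (@lo_embedding G)) by exact: valP z.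
apply: smallest_sub; first exact: orbits_locally_constant_closed.
by move=> _ [g _ <-] h P; apply: filterE.
Qed.

Lemma free_lgroup_leP (x y : free_lgroup G) :
  (x <= y)%O <-> forall Q (h : lo_carrier Q), (val x Q h <= val y Q h)%O.
Proof.
rewrite -Order.le_val; split=> [/lprod_leP xy Q h|xy].
  by have /oaut_leP := xy Q; apply.
by apply/lprod_leP => Q; apply/oaut_leP.
Qed.

Lemma embedding_mem g :
  lo_embedding g \in smallest (@lgroup_closed _ _) (range (@lo_embedding G)).
Proof. by apply/mem_set; apply: sub_gen_smallest; exists g. Qed.

Definition free_lgroup_of g : free_lgroup G :=
  GeneratedLGroup (embedding_mem g).

Lemma cone_separation P Q : Q <> P -> exists g, cone P g /\ cone Q g^-1.
Proof.
move=> QP; apply: contrapT => noG; apply: QP; apply: val_inj; apply/seteqP.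
have PQ g : cone P g -> cone Q g.
  move=> Pg.
  have g1 : g != 1 by apply/eqP => g1; apply: (@cone1 _ P); rewrite -g1.
  by have [//|Qg] := cone_total Q g1; case: noG; exists g.
split=> // g Qg.
have g1 : g != 1 by apply/eqP => g1; apply: (@cone1 _ Q); rewrite -g1.
by have [//|/PQ/(coneV Qg)] := cone_total P g1.
Qed.

(** The witnesses are the meets of [x] with the positive parts of the
translations by [h g h^-1] and [h g^-1 h^-1]. The conjugation is chosen so that
they send [h] to [h g] and [h g^-1]: at [P] only the first element moves [h],
and at [Q] only the second does. *)
Lemma not_basic_of_not_isolated :
  isolated [set: LO G] = set0 -> forall x : free_lgroup G, ~ basic_element x.
Proof.
move=> noiso x [x_gt1 x_tot].
have [P [h xPh]] : exists P (h : lo_carrier P), (h < val x P h)%O.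
  apply: contrapT => noPh; move: x_gt1.
  rewrite lt_neqAle => /andP[/eqP + x_ge1].
  apply; apply/le_anti; rewrite x_ge1 /=; apply/free_lgroup_leP => Q k.
  by rewrite leNgt; apply/negP => xk; apply: noPh; exists Q, k.
pose k : G := val x P h.
pose V := [set Q : LO G | orbit_map (val x) h Q = k /\ cone Q ((h : G)^-1 * k)].
have VP : nbhs P V.
  apply: filterI; first exact: free_lgroup_locally_constant.
  by apply: nbhs_cone; move: xPh; rewrite lo_ltE => /asboolP.
have [Q VQ QP] : exists2 Q, V Q & Q <> P.
  apply: contrapT => noQ; have : isolated [set: LO G] P.
    split; first exact/mem_set.
    exists V => //; apply/seteqP; split=> [Q [VQ _]|_ ->].
      by apply: contrapT => QP; apply: noQ; exists Q.
    by split=> //; exact: nbhs_singleton VP.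
  by rewrite noiso.
have [g [Pg Qg]] := cone_separation QP.
have xV R : V R -> ((h : lo_carrier R) < val x R h)%O.
  by case=> xR hk; rewrite [val x R h]xR lo_ltE; apply/asboolP.
pose y (f : G) : free_lgroup G :=
  (x `&` (1 `|` free_lgroup_of (h * f * h^-1)))%O.
have yE f R : val (y f) R h =
    Order.min (val x R h) (Order.max (h : lo_carrier R) (h * f : G)).
  rewrite -[LHS]/(Order.min (val x R h)
    (Order.max (h : lo_carrier R) (h * f * h^-1 * h : G))).
  by rewrite mulgVK.
have y_pos f R : V R -> cone R f -> ((h : lo_carrier R) < val (y f) R h)%O.
  move=> VR Rf; rewrite yE lt_min xV //= lt_max; apply/orP; right.
  by rewrite lo_ltE mulKg; apply/asboolP.
have y_neg f R : V R -> cone R f^-1 -> val (y f) R h = h.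
  move=> VR Rf; rewrite yE.
  have -> : Order.max (h : lo_carrier R) (h * f : G) = h.
    by apply/max_idPl/ltW; rewrite lo_ltE invgM mulgVK; apply/asboolP.
  exact/min_idPr/ltW/xV.
have y_in f : [set z | (1 <= z)%O && (z <= x)%O] (y f).
  by rewrite /= leIl lexI leUl (ltW x_gt1).
have VP' : V P by exact: nbhs_singleton VP.
have := x_tot _ _ (y_in g) (y_in g^-1).
case=> /free_lgroup_leP y_le.
  have := y_le P h; rewrite leNgt => /negP; apply.
  by rewrite (y_neg g^-1) ?invgK // y_pos.
have := y_le Q h; rewrite leNgt => /negP; apply.
by rewrite (y_neg g) // y_pos.
Qed.

End NoBasicElement.

Theorem corollary4p2 (n : nat) (n_gt1 : (1 < n)%N) :
  isolated [set: LO (free_group 'I_n)] = set0 /\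
  (forall x : free_lgroup (free_group 'I_n), ~ basic_element x).
Proof.
have noiso : isolated [set: LO (free_group 'I_n)] = set0.
  exact: (@LO_free_group_not_isolated _ (Ordinal (ltnW n_gt1)) (Ordinal n_gt1)).
by split; last exact: not_basic_of_not_isolated.
Qed.
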